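(* Let $\{M_\ell\}_{\ell\in\mathcal{L}^0}$ be the set of $\ell$-moments of a distribution $\mu_\beta$ which satisfies (G1) and (G2), and let $Q\subseteq\mathbb{R}^{|L|}$, $\dim Q=K$, be the linear subspace from (G2) supporting $\mu_\beta$. Let $\lambda^1,\dots,\lambda^K$, $\lambda^k=(\lambda^k_{jl})_{jl}$, be some (arbitrary) basis of $Q$, and let $\mathcal{E}(G^v\mid X=\ell)$ be the conditional moments calculated with respect to this basis. Then $$\alpha^k_{jl}=\lambda^k_{jl},\qquad h^v_\ell=M_\ell\cdot\mathcal{E}(G^v\mid X=\ell)$$ give a solution of the system $$\begin{cases}\sum_{k=1}^K\alpha^k_{jl}\,h^{v+\mathbf{1}_k}_\ell=h^v_{\ell+\boldsymbol{l}_j}, & J'\in\{0,\dots,J-1\},\ v\in\mathcal{V}[J'],\ \mathcal{J}\subseteq\{1,\dots,J\}\text{ with }|\mathcal{J}|>J',\\ & \ell\in\mathcal{L}^{[\mathcal{J}]},\ j\in\mathcal{J},\ l\in\{1,\dots,L_j\},\\ h^{(0,\dots,0)}_\ell=M_\ell, & \ell\in\mathcal{L}^0,\\ \sum_{v\in\mathcal{V}[J']}C_v\,h^v_{(0,\dots,0)}=1, & J'\in\{0,\dots,J\}.\end{cases}$$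
   Context: Setting: $J\ge1$ and $L=(L_1,\dots,L_J)$ are positive integers, $|L|=\sum_jL_j$; coordinates of $\mathbb{R}^{|L|}$ are indexed by pairs $(j,l)$, $1\le j\le J$, $1\le l\le L_j$. $\mathbb{S}^L=\{\beta\in\mathbb{R}^{|L|}:\beta_{jl}\ge0,\ \sum_l\beta_{jl}=1\text{ for all }j\}$. $\mu_\beta$ is a Borel probability measure on $\mathbb{R}^{|L|}$ with $\mu_\beta(\mathbb{S}^L)=1$. $\beta$ is a random vector with law $\mu_\beta$, and $X=(X_1,\dots,X_J)$ is a random vector, $X_j\in\{1,\dots,L_j\}$, with $\Pr(X_j=l\mid\beta)=\beta_{jl}$. (G1): conditionally on $\beta$, $X_1,\dots,X_J$ are mutually independent. (G2): there is a $K$-dimensional linear subspace $Q\subseteq\mathbb{R}^{|L|}$ with $\mu_\beta(Q)=1$ such that no proper linear subspace of $Q$ has $\mu_\beta$-measure $1$. Indices: $\mathcal{L}^0=\{\ell\in\mathbb{Z}^J:0\le\ell_j\le L_j\}$; for $\mathcal{J}\subseteq\{1,\dots,J\}$, $\mathcal{L}^{[\mathcal{J}]}=\{\ell\in\mathcal{L}^0:\ell_j=0\Leftrightarrow j\in\mathcal{J}\}$. The vector $\boldsymbol{l}_j\in\mathbb{Z}^J$ has $j$-th component $l$ and other components $0$; $\mathbf{1}_k\in\mathbb{Z}^K$ is the $k$-th unit vector. $\mathcal{V}[J']=\{v\in\mathbb{Z}_{\ge0}^K:\sum_kv_k=J'\}$; $C_v$ is the number of tuples $(w_1,\dots,w_{J'})\in\{1,\dots,K\}^{J'}$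 containing, for every $k$, exactly $v_k$ components equal to $k$. The unknowns of the system are real numbers $\alpha^k_{jl}$ and $h^v_\ell$ ($v\in\mathcal{V}[J']$, $\ell\in\mathcal{L}^{[\mathcal{J}]}$, $J'\le|\mathcal{J}|$). Moments: $M_\ell=M_\ell(\mu_\beta)=\int\prod_{j:\ell_j\ne0}\beta_{j\ell_j}\,\mu_\beta(d\beta)$. Conditional moments: given the basis, $G=(G_1,\dots,G_K)$ is the coordinate vector of $\beta$, i.e. $\beta=\sum_kG_k\lambda^k$. For $\ell\in\mathcal{L}^{[\mathcal{J}]}$, ''$X=\ell$'' means $X_j=\ell_j$ for all $j\notin\mathcal{J}$; $\mathcal{E}(\cdot\mid\cdot)$ is conditional expectation and $G^v=\prod_kG_k^{v_k}$. If $M_\ell=\Pr(X=\ell)=0$, the product $M_\ell\cdot\mathcal{E}(G^v\mid X=\ell)$ is read as $0$.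
   Formalization: The third family of equations (sum of C_v h^v_0 = 1) fails for an arbitrary basis (rescale it by 2), so it is claimed only for bases with sum_l λ^k_{jl} = 1 for all j, k; the first two families are claimed for an arbitrary basis. *)

(* Defs.v *)
From HB Require Import structures.
From mathcomp Require Import all_boot all_order all_algebra.
From mathcomp Require Import all_classical all_reals all_analysis.

Set Implicit Arguments.
Unset Strict Implicit.
Unset Printing Implicit Defensive.

Import Order.TTheory GRing.Theory Num.Theory.
Import numFieldNormedType.Exports.

Local Open Scope classical_set_scope.
Local Open Scope ring_scope.

(* R^|L| is the space of row vectors of length \sum_j L j; the pair (j, l) is
   located at position [tagnat.Rank j l].  Ordinals are 0-based: the category
   l in {1, .., L_j} is the ordinal of value l - 1 in 'I_(L j). *)
Definition cell (R : realType) (J : nat) (L : 'I_J -> nat)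
    (b : 'rV[R]_(\sum_(j < J) L j)) (j : 'I_J) (l : 'I_(L j)) : R :=
  b ord0 (tagnat.Rank j l).

Notation borelRL R L :=
  (g_sigma_algebraType (@open 'rV[R]_(\sum_j L j))).

Definition simplexL (R : realType) (J : nat) (L : 'I_J -> nat) :
    set 'rV[R]_(\sum_j L j) :=
  [set b | (forall j (l : 'I_(L j)), 0 <= cell b l) /\
           (forall j, \sum_(l < L j) cell b l = 1)].

(* f(Y) is a version of the conditional probability of A given Y *)
Definition is_cond_prob (R : realType) (d d' : measure_display)
    (Omega : measurableType d) (T : measurableType d') (P : probability Omega R)
    (Y : Omega -> T) (A : set Omega) (f : T -> R) : Prop :=
  [/\ measurable_fun setT f,
      P.-integrable setT (fun w => (f (Y w))%:E) &
      forall B : set T, measurable B ->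
        P (A `&` Y @^-1` B) = (\int[P]_(w in Y @^-1` B) (f (Y w))%:E)%E].

(* Versions are unique up to a null set, so that quantifying over all of them
   or over some of them is the same. *)
Definition G1 (R : realType) (d d' : measure_display)
    (Omega : measurableType d) (T : measurableType d') (P : probability Omega R)
    (Y : Omega -> T) (J : nat) (L : 'I_J -> nat)
    (X : forall j : 'I_J, Omega -> 'I_(L j)) : Prop :=
  forall (S : {set 'I_J}) (A : forall j, {set 'I_(L j)}) (f : 'I_J -> T -> R),
    (forall j, j \in S -> is_cond_prob P Y [set w | X j w \in A j] (f j)) ->
    is_cond_prob P Y [set w | forall j, j \in S -> X j w \in A j]
      (fun y => \prod_(j in S) f j y).

Definition G2 (R : realType) (J : nat) (L : 'I_J -> nat)
    (mu : probability (borelRL R L) R) (K : nat)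
    (Q : {vspace 'rV[R]_(\sum_j L j)}) : Prop :=
  [/\ \dim Q = K, mu [set b | b \in Q] = 1%E &
      forall Q' : {vspace 'rV[R]_(\sum_j L j)},
        (Q' <= Q)%VS -> Q' != Q -> mu [set b | b \in Q'] <> 1%E].

(* The multi-indices l in L^0: 0 <= l_j <= L_j.  Here the values are not
   shifted: 0 is the missing component, and [lift ord0 l] (of value l + 1) is
   the category represented by l : 'I_(L j). *)
Definition mindex (J : nat) (L : 'I_J -> nat) : Type :=
  forall j : 'I_J, 'I_(L j).+1.

Definition mindex0 (J : nat) (L : 'I_J -> nat) : mindex L := fun j => ord0.

(* the multi-indices that vanish exactly on JJ *)
Definition in_LJ (J : nat) (L : 'I_J -> nat) (JJ : {set 'I_J}) (ell : mindex L)
  : Prop := forall j, (ell j == ord0) = (j \in JJ).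

(* addition of the integer vector with l (1-based) at position j and 0 elsewhere;
   [inord] is exact when ell j = 0, the only case in which this is used *)
Definition add_cat (J : nat) (L : 'I_J -> nat) (ell : mindex L) (j : 'I_J)
    (l : 'I_(L j)) : mindex L :=
  fun i => inord (ell i + (if i == j then l.+1 else 0))%N.

(* \prod_(j : ell_j != 0) b_(j, ell_j) *)
Definition monomial (R : realType) (J : nat) (L : 'I_J -> nat) (ell : mindex L)
    (b : 'rV[R]_(\sum_j L j)) : R :=
  \prod_(j < J) if unlift ord0 (ell j) is Some l then cell b l else 1.

Definition moment (R : realType) (J : nat) (L : 'I_J -> nat)
    (mu : probability (borelRL R L) R) (ell : mindex L) : R :=
  \int[mu]_b monomial ell b.

(* "X = ell": X_j = ell_j whenever ell_j != 0 *)
Definition X_eq (Omega : Type) (J : nat) (L : 'I_J -> nat)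
    (X : forall j : 'I_J, Omega -> 'I_(L j)) (ell : mindex L) : set Omega :=
  [set w | forall j, ell j != ord0 -> ell j = lift ord0 (X j w)].

(* E(Z | A) for an event A; it is 0 when P A = 0, since x / 0 = 0 *)
Definition cond_mean (R : realType) (d : measure_display)
    (Omega : measurableType d) (P : probability Omega R) (Z : Omega -> R)
    (A : set Omega) : R :=
  (\int[P]_(w in A) Z w) / fine (P A).

(* G^v for the coordinates G of b in the basis lam.  [coord lam k] is a linear
   form on the whole space; off the span of lam, a null set for the law of beta,
   its values are irrelevant. *)
Definition Gpow (R : realType) (n K : nat) (lam : K.-tuple 'rV[R]_n)
    (v : 'I_K -> nat) (b : 'rV[R]_n) : R :=
  \prod_(k < K) coord lam k b ^+ v k.

Definition vincr (K : nat) (v : 'I_K -> nat) (k : 'I_K) : 'I_K -> nat :=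
  fun i => (v i + (i == k))%N.

Definition vsize (K : nat) (v : 'I_K -> nat) : nat := (\sum_(k < K) v k)%N.

(* C_v, the number of words w of length \sum_k v_k with v_k letters k *)
Definition Cv (K : nat) (v : 'I_K -> nat) : nat :=
  #|[pred w : (vsize v).-tuple 'I_K | [forall k, count_mem k w == v k]]|.

Definition vnat (K m : nat) (v : {ffun 'I_K -> 'I_m.+1}) : 'I_K -> nat :=
  fun k => v k.

(* The three families of equations of the system, for unknowns
   alpha^k_(j, l) and h^v_ell; only the h^v_ell with \sum_k v_k at most the
   number of zero components of ell occur. *)
Definition recurrence_eqs (R : realType) (J : nat) (L : 'I_J -> nat) (K : nat)
    (alpha : 'I_K -> forall j : 'I_J, 'I_(L j) -> R)
    (h : ('I_K -> nat) -> mindex L -> R) : Prop :=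
  forall (J' : nat) (v : 'I_K -> nat) (JJ : {set 'I_J}) (ell : mindex L)
      (j : 'I_J) (l : 'I_(L j)),
    (J' < J)%N -> vsize v = J' -> (J' < #|JJ|)%N -> in_LJ JJ ell -> j \in JJ ->
    \sum_(k < K) alpha k j l * h (vincr v k) ell = h v (add_cat ell l).

Definition moment_eqs (R : realType) (J : nat) (L : 'I_J -> nat) (K : nat)
    (M : mindex L -> R) (h : ('I_K -> nat) -> mindex L -> R) : Prop :=
  forall ell : mindex L, h (fun=> 0%N) ell = M ell.

(* V[J'] is the set of v : {ffun 'I_K -> 'I_J'.+1} with sum J': the bound on the
   components follows from the sum. *)
Definition normalization_eqs (R : realType) (J : nat) (L : 'I_J -> nat)
    (K : nat) (h : ('I_K -> nat) -> mindex L -> R) : Prop :=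
  forall J' : nat, (J' <= J)%N ->
    \sum_(v : {ffun 'I_K -> 'I_J'.+1} | vsize (vnat v) == J')
      (Cv (vnat v))%:R * h (vnat v) (mindex0 L) = 1.

(* Every basis vector satisfies the affine constraints of the simplex.  For a
   basis of the support this says that the coordinates of beta add up to 1.
   [normalization_eqs] needs it: the left-hand side is E((\sum_k G_k)^J'), and
   replacing lam by 2 *: lam divides it by 2^J'. *)
Definition normalized_basis (R : realType) (J : nat) (L : 'I_J -> nat)
    (K : nat) (lam : K.-tuple 'rV[R]_(\sum_j L j)) : Prop :=
  forall (k : 'I_K) (j : 'I_J), \sum_(l < L j) cell (tnth lam k) l = 1.

(* Main.v *)
Require Import Defs.
From HB Require Import structures.
From mathcomp Require Import all_boot all_order all_algebra.
From mathcomp Require Import all_classical all_reals all_analysis.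
From mathcomp Require Import measurable_realfun ring.

(** The whole system comes from one formula: for every multi-index ell and
    every exponent v,

      h^v_ell = \int G^v(b) * monomial ell b  mu(db),

    the right-hand side being an ordinary integral against the law of beta.

    To prove it, (G1) identifies [monomial ell] as the conditional probability
    of the event X = ell given beta.  A version f of the conditional
    probability of A given Y is the Radon-Nikodym density, with respect to the
    law of Y, of the measure B |-> P(A /\ Y \in B); the change of variables for
    densities then gives E(g(Y); A) = \int g f for every integrable g
    ([integral_cond_prob]).  Taking g = 1 shows that P(X = ell) = M_ell, so
    that multiplying the conditional mean by M_ell cancels its denominator,
    also when M_ell = 0, as both sides are then zero ([moment_cond_mean]).

    Under the integral, each family of equations is an identity between
    functions of b on the set where b lies both in the simplex and in Q, a set
    of full measure:
    - recurrence: beta_jl = \sum_k G_k lam^k_jl on Q, and passing from ell to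
      ell + l_j multiplies the monomial by beta_jl;
    - moments: G^0 = 1;
    - normalization: by the multinomial theorem ([multinomial_Cv]) the sum of
      C_v G^v over the v of size n is (\sum_k G_k)^n, and the coordinates sum
      to 1 when the basis vectors satisfy the affine constraints of the simplex
      ([sum_coord_normalized]).

    All functions involved are polynomials in b, hence bounded on the simplex;
    [mbounded] records this, and it is the source of all integrability. *)

Set Implicit Arguments.
Unset Strict Implicit.
Unset Printing Implicit Defensive.

Import Order.TTheory GRing.Theory Num.Theory.
Import numFieldNormedType.Exports.

Local Open Scope classical_set_scope.
Local Open Scope ring_scope.

(** * Conditional probabilities as densities *)

(** The restricted measure gives no mass to the complement of A and coincides
    with mu inside A. *)
Lemma integral_mrestr (R : realType) (d : measure_display)
    (T : measurableType d) (mu : {measure set T -> \bar R}) (A : set T)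
    (mA : measurable A) (f : T -> \bar R) :
  mu.-integrable setT f ->
  (\int[mrestr mu mA]_x f x = \int[mu]_(x in A) f x)%E.
Proof.
move=> fi; have [mf fioo] := integrableP _ _ _ fi.
have fri : (mrestr mu mA).-integrable setT f.
  apply/integrableP; split => //.
  apply: le_lt_trans fioo; apply: ge0_le_measure_integral => //.
  - by move=> B mB; apply: measureIl.
  - exact: measurableT_comp.
rewrite (@negligible_integral _ _ _ _ setT (~` A)) //=; last 2 first.
- exact: measurableC.
- by rewrite /mrestr setICl measure0.
rewrite setDE setCK setTI; apply: eq_measure_integral => B mB BA.
by rewrite /= /mrestr setIidl.
Qed.

(** Bundling the measurability of Y with Y lets the image be recognized as a
    finite measure, to which the Radon-Nikodym theorem applies. *)
Definition image_measure (R : realType) (d d' : measure_display)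
    (Omega : measurableType d) (T : measurableType d')
    (m : {finite_measure set Omega -> \bar R}) (Y : {mfun Omega >-> T}) :
  set T -> \bar R := pushforward m Y.

Section image_measure_finite.
Context (R : realType) (d d' : measure_display)
  (Omega : measurableType d) (T : measurableType d')
  (m : {finite_measure set Omega -> \bar R}) (Y : {mfun Omega >-> T}).

Let image_measure0 : image_measure m Y set0 = 0%E.
Proof. exact: measure0. Qed.

Let image_measure_ge0 B : (0 <= image_measure m Y B)%E.
Proof. exact: measure_ge0. Qed.

Let image_measure_sigma_additive : semi_sigma_additive (image_measure m Y).
Proof. exact: measure_semi_sigma_additive. Qed.

HB.instance Definition _ := isMeasure.Build _ _ _ (image_measure m Y)
  image_measure0 image_measure_ge0 image_measure_sigma_additive.

Let image_measure_fin_num : fin_num_fun (image_measure m Y).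
Proof.
move=> B mB; apply: fin_num_measure.
by rewrite -[X in measurable X]setTI; exact: measurable_funPT.
Qed.

HB.instance Definition _ := Measure_isFinite.Build _ _ _ (image_measure m Y)
  image_measure_fin_num.

End image_measure_finite.

Local Open Scope charge_scope.

(** The defining property of a conditional probability is the case where g is
    an indicator.  It says that f is the density, with respect to the law of Y,
    of the image under Y of P restricted to A; so f is almost everywhere equal
    to the Radon-Nikodym derivative, for which the change of variables formula
    holds with any integrable g. *)
Lemma integral_cond_prob (R : realType) (d d' : measure_display)
    (Omega : measurableType d) (T : measurableType d') (P : probability Omega R)
    (Y : {mfun Omega >-> T}) (A : set Omega) (f g : T -> R) :
  measurable A -> is_cond_prob P Y A f -> measurable_fun setT g ->
  P.-integrable setT (fun w => (g (Y w))%:E) ->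
  (\int[P]_(w in A) (g (Y w))%:E
   = \int[distribution P Y]_y (g y * f y)%:E)%E.
Proof.
move=> mA [mf fi fE] mg gi.
have mY : measurable_fun setT Y by [].
have mEf : measurable_fun setT (EFin \o f) by exact/measurable_EFinP.
have mEg : measurable_fun setT (EFin \o g) by exact/measurable_EFinP.
pose PA : {finite_measure set Omega -> \bar R} := mrestr P mA.
pose mu : {finite_measure set T -> \bar R} := distribution P Y.
pose nu : {finite_measure set T -> \bar R} := image_measure PA Y.
have fmu : mu.-integrable setT (EFin \o f) by apply: integrable_pushforward.
have nuE B : measurable B -> nu B = (\int[mu]_(y in B) (f y)%:E)%E.
  move=> mB; rewrite integral_pushforward //.
    by rewrite /nu /= /image_measure /pushforward /PA /= /mrestr setIC; exact: fE.
  apply: integrableS fi => //.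
  by rewrite -[X in measurable X]setTI; exact: mY.
have numu : nu `<< mu.
  apply/null_content_dominatesP => B mB muB; rewrite nuE //.
  apply: null_set_integral => //; exact: measurable_funTS.
have gPA : PA.-integrable setT ((EFin \o g) \o Y).
  apply/integrableP; split; first exact: measurableT_comp.
  have [_] := integrableP _ _ _ gi.
  apply: le_lt_trans; apply: ge0_le_measure_integral => //.
  - by move=> B mB; apply: measureIl.
  - by apply: measurableT_comp => //; exact: measurableT_comp.
have gnu : nu.-integrable setT (EFin \o g). by apply: integrable_pushforward.
transitivity (\int[nu]_y (g y)%:E)%E.
  by rewrite integral_pushforward// integral_mrestr.
rewrite -(Radon_Nikodym_change_of_variables numu) //.
apply: ae_eq_integral => //.
- by apply: emeasurable_funM => //; apply: measurable_int; apply: Radon_Nikodym_integrable.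
- by apply/measurable_EFinP; exact: measurable_funM.
- have : ae_eq mu setT ('d (charge_of_finite_measure nu) '/d mu) (EFin \o f).
    apply: integral_ae_eq => //; first exact: Radon_Nikodym_integrable.
    by move=> B _ mB; rewrite -Radon_Nikodym_integral// -nuE.
  by apply: filterS => y /= /(_ I) ->.
Qed.

(** * Bounded functions on a set of full measure *)

Lemma measurable_forall (d : measure_display) (T : measurableType d)
    (I : finType) (A : I -> set T) :
  (forall i, measurable (A i)) -> measurable [set x | forall i, A i x].
Proof.
move=> mA.
have -> : [set x | forall i, A i x] = \bigcap_(i in setT) A i.
  by apply/seteqP; split=> x Ax i; [move=> _; exact: Ax | exact: Ax].
by apply: fin_bigcap_measurable => // i _; exact: mA.
Qed.

Lemma full_measure_ae (R : realType) (d : measure_display)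
    (T : measurableType d) (mu : probability T R) (B : set T) :
  measurable B -> mu B = 1%E -> \forall x \ae mu, B x.
Proof.
move=> mB muB; exists (~` B); split; [exact: measurableC| |by []].
by rewrite [LHS]probability_setC// muB subee.
Qed.

Lemma full_measureI (R : realType) (d : measure_display)
    (T : measurableType d) (mu : probability T R) (A B : set T) :
  measurable A -> measurable B -> mu A = 1%E -> mu B = 1%E ->
  mu (A `&` B) = 1%E.
Proof.
move=> mA mB muA muB; rewrite -muA (measureDI mu mA mB).
rewrite [X in _ = (X + _)%E](_ : _ = 0%E) ?add0e //.
apply: (@subset_measure0 _ _ _ mu _ (~` B)).
- exact: measurableD.
- exact: measurableC.
- by move=> x [].
- by rewrite [LHS]probability_setC // muB subee.
Qed.

(** Boundedness is only asked on B: coordinate forms are unbounded on the whole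
    space, but bounded on the simplex, which has full measure. *)
Definition mbounded (R : realType) (d : measure_display)
    (T : measurableType d) (B : set T) (f : T -> R) : Prop :=
  measurable_fun setT f /\ exists M, forall x, B x -> `|f x| <= M.

Lemma mbounded_cst (R : realType) (d : measure_display)
    (T : measurableType d) (B : set T) (c : R) : mbounded B (fun=> c).
Proof. by split; [exact: measurable_cst | exists `|c|]. Qed.

Lemma mboundedM (R : realType) (d : measure_display)
    (T : measurableType d) (B : set T) (f g : T -> R) :
  mbounded B f -> mbounded B g -> mbounded B (fun x => f x * g x).
Proof.
move=> [mf [M fM]] [mg [N gN]]; split; first exact: measurable_funM.
by exists (M * N) => x Bx; rewrite normrM ler_pM// ?fM ?gN.
Qed.

Lemma mboundedX (R : realType) (d : measure_display)
    (T : measurableType d) (B : set T) (f : T -> R) (n : nat) :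
  mbounded B f -> mbounded B (fun x => f x ^+ n).
Proof.
move=> bf; elim: n => [|n IH]; first exact: mbounded_cst.
by under eq_fun do rewrite exprS; exact: mboundedM.
Qed.

Lemma mbounded_sum (R : realType) (d : measure_display)
    (T : measurableType d) (B : set T) (I : Type) (s : seq I) (p : pred I)
    (f : I -> T -> R) :
  (forall i, p i -> mbounded B (f i)) ->
  mbounded B (fun x => \sum_(i <- s | p i) f i x).
Proof.
move=> bf; elim: s => [|i s IH].
  by under eq_fun do rewrite big_nil; exact: mbounded_cst.
under eq_fun do rewrite big_cons.
have [pi|//] := boolP (p i); have [mf [M fM]] := bf _ pi; have [mg [N gN]] := IH.
split; first exact: measurable_funD.
by exists (M + N) => x Bx; rewrite (le_trans (ler_normD _ _))// lerD ?fM ?gN.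
Qed.

Lemma mbounded_prod (R : realType) (d : measure_display)
    (T : measurableType d) (B : set T) (I : Type) (s : seq I)
    (f : I -> T -> R) :
  (forall i, mbounded B (f i)) -> mbounded B (fun x => \prod_(i <- s) f i x).
Proof.
move=> bf; elim: s => [|i s IH].
  by under eq_fun do rewrite big_nil; exact: mbounded_cst.
by under eq_fun do rewrite big_cons; exact: mboundedM.
Qed.

Lemma mbounded_integrable (R : realType) (d : measure_display)
    (T : measurableType d) (mu : probability T R) (B : set T) (f : T -> R) :
  measurable B -> mu B = 1%E -> mbounded B f ->
  mu.-integrable setT (fun x => (f x)%:E).
Proof.
move=> mB muB [mf [M fM]]; apply/integrableP.
have mEf : measurable_fun setT (fun x => (f x)%:E) by exact/measurable_EFinP.
split => //; apply: le_lt_trans.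
  apply: (@integral_le_bound _ _ _ mu setT _ `|M|%:E) => //.
  apply: filterS (full_measure_ae mB muB) => x Bx _.
  by rewrite lee_fin (le_trans (fM _ Bx))// ler_norm.
by rewrite [X in (_ * X)%E](@probability_setT _ _ _ mu) mule1 ltry.
Qed.

Lemma eq_Rintegral_full (R : realType) (d : measure_display)
    (T : measurableType d) (mu : probability T R) (B : set T) (f g : T -> R) :
  measurable B -> mu B = 1%E ->
  measurable_fun setT f -> measurable_fun setT g ->
  (forall x, B x -> f x = g x) ->
  \int[mu]_x f x = \int[mu]_x g x.
Proof.
move=> mB muB mf mg fg; congr fine; apply: ae_eq_integral => //;
  [exact/measurable_EFinP|exact/measurable_EFinP|].
by apply: filterS (full_measure_ae mB muB) => x Bx _; rewrite fg.
Qed.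

Lemma Rintegral_lincomb (R : realType) (d : measure_display)
    (T : measurableType d) (mu : probability T R) (B : set T) (I : Type)
    (s : seq I) (p : pred I) (c : I -> R) (f : I -> T -> R) :
  measurable B -> mu B = 1%E -> (forall i, mbounded B (f i)) ->
  \sum_(i <- s | p i) c i * \int[mu]_x f i x
  = \int[mu]_x (\sum_(i <- s | p i) c i * f i x).
Proof.
move=> mB muB bf.
have bcf i : mbounded B (fun x => c i * f i x).
  by apply: mboundedM => //; exact: mbounded_cst.
elim: s => [|i s IH].
  rewrite big_nil; under eq_Rintegral do rewrite big_nil.
  by rewrite Rintegral_cst ?mul0r.
rewrite big_cons IH; under [RHS]eq_Rintegral do rewrite big_cons.
case: (p i) => //; rewrite RintegralD //.
- by rewrite RintegralZl //; exact: (mbounded_integrable mB).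
- exact: (mbounded_integrable mB).
- by apply: (mbounded_integrable mB) => //; exact: mbounded_sum.
Qed.

(** * Measurability on the space of parameters *)

Lemma continuous_measurable_borel (R : realType) (T : ptopologicalType)
    (f : T -> R) :
  continuous f ->
  measurable_fun setT (f : g_sigma_algebraType (@open T) -> R).
Proof.
move=> /continuousP cf; apply: (measurability _ (RGenOpens.measurableE R)).
move=> _ [_ [a [b ->] <-]]; rewrite setTI; apply: sub_sigma_algebra.
exact/cf/interval_open.
Qed.

(** A nonnegative term of a sum equal to 1 is at most 1. *)
Lemma simplexL_ge0_le1 (R : realType) (J : nat) (L : 'I_J -> nat)
    (b : 'rV[R]_(\sum_j L j)) i :
  simplexL b -> 0 <= b ord0 i <= 1.
Proof.
move=> [b_ge0 b_sum]; rewrite -(tagnat.sig2K i).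
rewrite -/(cell b (tagnat.sig2 i)) b_ge0 /= -(b_sum (tagnat.sig1 i)).
by rewrite (bigD1 (tagnat.sig2 i)) //= lerDl sumr_ge0.
Qed.

Lemma mbounded_coord (R : realType) (J : nat) (L : 'I_J -> nat) i :
  mbounded (@simplexL R J L : set (borelRL R L)) (fun b => b ord0 i).
Proof.
split; first by apply: continuous_measurable_borel; exact: coord_continuous.
by exists 1 => b /(simplexL_ge0_le1 i) /andP[b0 b1]; rewrite ger0_norm.
Qed.

(** A linear form is a combination of the entries of its argument. *)
Lemma mbounded_linear (R : realType) (J : nat) (L : 'I_J -> nat)
    (phi : {linear 'rV[R]_(\sum_j L j) -> R^o}) :
  mbounded (@simplexL R J L : set (borelRL R L)) phi.
Proof.
have -> : phi = (fun b => \sum_i b ord0 i * phi (delta_mx 0 i)) :> (_ -> _).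
  apply/funext => b; rewrite {1}(row_sum_delta b) linear_sum.
  by apply: eq_bigr => i _; rewrite linearZ.
apply: mbounded_sum => i _.
by apply: mboundedM; [exact: mbounded_coord | exact: mbounded_cst].
Qed.

Lemma measurable_simplexL (R : realType) (J : nat) (L : 'I_J -> nat) :
  measurable (@simplexL R J L : set (borelRL R L)).
Proof.
have mcell j (l : 'I_(L j)) :
    measurable_fun setT (fun b : borelRL R L => cell b l).
  by have [] := mbounded_coord R (tagnat.Rank j l).
apply: measurableI; apply: measurable_forall => j.
  apply: measurable_forall => l.
  rewrite [X in measurable X](_ : _
      = (fun b : borelRL R L => cell b l) @^-1` `[0, +oo[); last first.
    by apply/seteqP; split=> b /=; rewrite in_itv /= andbT.
  by rewrite -[X in measurable X]setTI; exact: mcell.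
have mS : measurable_fun setT (fun b : borelRL R L => \sum_(l < L j) cell b l).
  by apply: measurable_sum.
rewrite [X in measurable X](_ : _
  = (fun b : borelRL R L => \sum_(l < L j) cell b l) @^-1` [set 1]) //.
by rewrite -[X in measurable X]setTI; exact: mS.
Qed.

(** A subspace is the zero set of finitely many measurable functions: the
    entries of b minus its projection on Q. *)
Lemma measurable_vspace (R : realType) (J : nat) (L : 'I_J -> nat)
    (Q : {vspace 'rV[R]_(\sum_j L j)}) :
  measurable ([set b | b \in Q] : set (borelRL R L)).
Proof.
pose phi i (b : 'rV[R]_(\sum_j L j)) : R^o := (b - projv Q b) ord0 i.
have phiP i : linear (phi i).
  by move=> a b c; rewrite /phi linearP !mxE /= opprD addrACA scalerBr.
pose lphi i := HB.pack_for {linear 'rV[R]_(\sum_j L j) -> R^o} (phi i)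
  (GRing.isLinear.Build _ _ _ _ _ (phiP i)).
have -> : [set b | b \in Q] = [set b | forall i, lphi i b = 0].
  apply/seteqP; split=> b /= => [bQ i|b0].
    by rewrite /phi projv_id // subrr mxE.
  suff -> : b = projv Q b by exact: memv_proj.
  by apply/rowP => i; apply/eqP; rewrite -subr_eq0; apply/eqP;
    have := b0 i; rewrite /= /phi !mxE.
apply: (@measurable_forall _ (borelRL R L)) => i.
have [mphi _] := mbounded_linear (lphi i).
rewrite [X in measurable X](_ : _ = lphi i @^-1` [set 0]) //.
by rewrite -[X in measurable X]setTI; exact: mphi.
Qed.

(** * Multi-indices and the events X = ell *)

Definition monomial_factor (R : realType) (J : nat) (L : 'I_J -> nat)
    (ell : mindex L) (j : 'I_J) (b : 'rV[R]_(\sum_j L j)) : R :=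
  if unlift ord0 (ell j) is Some l then cell b l else 1.

(** (G1) produces a product over the observed components only; the remaining
    factors of the monomial are 1. *)
Lemma monomialE (R : realType) (J : nat) (L : 'I_J -> nat) (ell : mindex L)
    (b : 'rV[R]_(\sum_j L j)) :
  monomial ell b = \prod_(j in [set j | ell j != ord0]%SET) monomial_factor ell j b.
Proof.
rewrite [RHS]big_mkcond; apply: eq_bigr => j _; rewrite inE /monomial_factor.
by case: unliftP => [l ->|->]; rewrite ?eqxx //= eq_sym neq_lift.
Qed.

Lemma monomial0 (R : realType) (J : nat) (L : 'I_J -> nat)
    (b : 'rV[R]_(\sum_j L j)) : monomial (mindex0 L) b = 1.
Proof. by apply: big1 => j _; rewrite /mindex0 unlift_none. Qed.

Lemma add_catE (J : nat) (L : 'I_J -> nat) (ell : mindex L) (j : 'I_J)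
    (l : 'I_(L j)) :
  ell j = ord0 -> add_cat ell l j = lift ord0 l.
Proof. by move=> ej; apply: ord_inj; rewrite /add_cat ej eqxx lift0 /= add0n inordK ?ltnS. Qed.

Lemma add_cat_neq (J : nat) (L : 'I_J -> nat) (ell : mindex L) (j : 'I_J)
    (l : 'I_(L j)) (i : 'I_J) : i != j -> add_cat ell l i = ell i.
Proof. by move=> /negPf ij; rewrite /add_cat ij addn0 inord_val. Qed.

Lemma monomial_add_cat (R : realType) (J : nat) (L : 'I_J -> nat)
    (ell : mindex L) (j : 'I_J) (l : 'I_(L j)) (b : 'rV[R]_(\sum_j L j)) :
  ell j = ord0 -> monomial (add_cat ell l) b = cell b l * monomial ell b.
Proof.
move=> ej; rewrite /monomial (bigD1 j) //= [in RHS](bigD1 j) //=.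
rewrite add_catE // liftK ej unlift_none mul1r; congr (_ * _).
by apply: eq_bigr => i /add_cat_neq ->.
Qed.

Lemma mbounded_monomial (R : realType) (J : nat) (L : 'I_J -> nat)
    (ell : mindex L) :
  mbounded (@simplexL R J L : set (borelRL R L)) (monomial ell).
Proof.
apply: mbounded_prod => j; case: (unlift _ _) => [l|].
  exact: mbounded_coord.
exact: mbounded_cst.
Qed.

Lemma mbounded_Gpow (R : realType) (J : nat) (L : 'I_J -> nat) (K : nat)
    (lam : K.-tuple 'rV[R]_(\sum_j L j)) (v : 'I_K -> nat) :
  mbounded (@simplexL R J L : set (borelRL R L)) (Gpow lam v).
Proof.
apply: mbounded_prod => k; apply: mboundedX.
exact: (mbounded_linear (coord lam k)).
Qed.

Lemma measurable_X_eq (J : nat) (L : 'I_J -> nat) (d : measure_display)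
    (Omega : measurableType d) (X : forall j : 'I_J, Omega -> 'I_(L j))
    (ell : mindex L) :
  (forall j (l : 'I_(L j)), measurable [set w | X j w = l]) ->
  measurable (X_eq X ell).
Proof.
move=> mX; apply: measurable_forall => j.
case: (unliftP ord0 (ell j)) => [l ellj|ellj].
  rewrite [X in measurable X](_ : _ = [set w | X j w = l]) //.
  apply/seteqP; split=> w /=; rewrite ellj.
    by move=> /(_ _)/lift_inj ->//; rewrite eq_sym neq_lift.
  by move=> ->.
rewrite [X in measurable X](_ : _ = setT) //.
by apply/seteqP; split=> w //= _; rewrite ellj eqxx.
Qed.

(** The event X = ell is an intersection of the events X_j = ell_j over the
    observed j, and conditional independence multiplies their conditional
    probabilities. *)
Lemma cond_prob_X_eq (R : realType) (J : nat) (L : 'I_J -> nat)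
    (d : measure_display) (Omega : measurableType d) (P : probability Omega R)
    (beta : Omega -> borelRL R L) (X : forall j : 'I_J, Omega -> 'I_(L j))
    (ell : mindex L) :
  (forall j (l : 'I_(L j)),
     is_cond_prob P beta [set w | X j w = l] (fun b => cell b l)) ->
  G1 P beta X ->
  is_cond_prob P beta (X_eq X ell) (monomial ell).
Proof.
move=> X_cond hG1.
pose S : {set 'I_J} := [set j | ell j != ord0]%SET.
pose A j : {set 'I_(L j)} := [set l | ell j == lift ord0 l]%SET.
have -> : X_eq X ell = [set w | forall j, j \in S -> X j w \in A j].
  apply/seteqP; split=> w /= Xw j.
    by rewrite !inE => /Xw /eqP.
  by move=> ellj; apply/eqP; have := Xw j; rewrite !inE; exact.
have -> : monomial ell = (fun b => \prod_(j in S) monomial_factor ell j b) :> (_ -> R).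
  by apply/funext => b; exact: monomialE.
apply: hG1 => j; rewrite inE /monomial_factor => ellj.
case: (unliftP ord0 (ell j)) ellj => [l ellj _|->]; last by rewrite eqxx.
rewrite (_ : [set w | _] = [set w | X j w = l]); first exact: X_cond.
apply/seteqP; split=> w /=; rewrite inE ellj.
  by move=> /eqP /lift_inj.
by move=> ->.
Qed.

(** * The integral formula for M_ell times a conditional moment *)

Lemma integrable_law (R : realType) (d d' : measure_display)
    (Omega : measurableType d) (T : measurableType d') (P : probability Omega R)
    (mu : probability T R) (Y : {mfun Omega >-> T}) (g : T -> R) :
  (forall B, measurable B -> distribution P Y B = mu B) ->
  mu.-integrable setT (fun y => (g y)%:E) ->
  P.-integrable setT (fun w => (g (Y w))%:E).
Proof.
move=> Ymu /integrableP[mg gi]; apply/integrableP; split.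
  exact: (measurableT_comp mg).
rewrite -(ge0_integral_distribution Y (f := fun y => `|(g y)%:E|%E)) //; last exact: measurableT_comp.
by rewrite (eq_measure_integral mu) // => B mB _; exact: Ymu.
Qed.

Lemma Rintegral_cond_prob (R : realType) (d d' : measure_display)
    (Omega : measurableType d) (T : measurableType d') (P : probability Omega R)
    (mu : probability T R) (Y : {mfun Omega >-> T}) (A : set Omega)
    (f g : T -> R) :
  measurable A -> is_cond_prob P Y A f ->
  (forall B, measurable B -> distribution P Y B = mu B) ->
  measurable_fun setT g -> mu.-integrable setT (fun y => (g y)%:E) ->
  \int[P]_(w in A) g (Y w) = \int[mu]_y (g y * f y).
Proof.
move=> mA Af Ymu mg gi; congr fine.
rewrite (integral_cond_prob mA Af mg (integrable_law Ymu gi)).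
by apply: eq_measure_integral => B mB _; exact: Ymu.
Qed.

(** With g = 1, the total integral of f is P A, so the factor cancels the
    denominator of the conditional mean.  If P A = 0 this cancellation fails,
    but then the integral of g(Y) over the null set A vanishes as well. *)
Lemma moment_cond_mean (R : realType) (d d' : measure_display)
    (Omega : measurableType d) (T : measurableType d') (P : probability Omega R)
    (mu : probability T R) (Y : {mfun Omega >-> T}) (A : set Omega)
    (f g : T -> R) :
  measurable A -> is_cond_prob P Y A f ->
  (forall B, measurable B -> distribution P Y B = mu B) ->
  measurable_fun setT g -> mu.-integrable setT (fun y => (g y)%:E) ->
  (\int[mu]_y f y) * cond_mean P (fun w => g (Y w)) A
  = \int[mu]_y (g y * f y).
Proof.
move=> mA Af Ymu mg gi; rewrite /cond_mean.
have PA : fine (P A) = \int[mu]_y f y.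
  under eq_Rintegral do rewrite -[f _]mul1r.
  rewrite -(Rintegral_cond_prob (g := cst 1) mA Af Ymu) //=.
    by rewrite Rintegral_cst // mul1r.
  exact: finite_measure_integrable_cst.
rewrite -PA -(Rintegral_cond_prob mA Af Ymu mg gi).
have [PA0|PA0] := eqVneq (fine (P A)) 0; last by rewrite mulrC divfK.
rewrite PA0 mul0r /Rintegral null_set_integral //.
  by apply/measurable_EFinP; apply: measurable_funTS; exact: measurableT_comp.
by apply/eqP; rewrite -fine_eq0 ?PA0 ?fin_num_measure.
Qed.

(** * Coordinates in the basis *)

Lemma Gpow0 (R : realType) (n K : nat) (lam : K.-tuple 'rV[R]_n) b :
  Gpow lam (fun=> 0%N) b = 1.
Proof. by apply: big1 => k _; rewrite expr0. Qed.

Lemma Gpow_incr (R : realType) (n K : nat) (lam : K.-tuple 'rV[R]_n)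
    (v : 'I_K -> nat) (k : 'I_K) b :
  Gpow lam (vincr v k) b = Gpow lam v b * coord lam k b.
Proof.
rewrite /Gpow (bigD1 k) //= [in RHS](bigD1 k) //= /vincr eqxx addn1 exprSr.
rewrite -mulrA [coord lam k b * _]mulrC mulrA; congr (_ * _ * _).
by apply: eq_bigr => i /negPf ->; rewrite addn0.
Qed.

Lemma cell_coord (R : realType) (J : nat) (L : 'I_J -> nat) (K : nat)
    (Q : {vspace 'rV[R]_(\sum_j L j)}) (lam : K.-tuple 'rV[R]_(\sum_j L j))
    (b : 'rV[R]_(\sum_j L j)) (j : 'I_J) (l : 'I_(L j)) :
  basis_of Q lam -> b \in Q ->
  cell b l = \sum_(k < K) coord lam k b * cell (tnth lam k) l.
Proof.
move=> lamQ bQ; rewrite /cell {1}(coord_basis lamQ bQ) summxE.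
by apply: eq_bigr => k _; rewrite mxE (tnth_nth 0).
Qed.

(** Summing the coordinate expansion of b over the cells of a single block j
    gives 1 on the left, and the sum of the coordinates on the right since each
    basis vector also sums to 1 over that block.  A block exists because J is
    positive. *)
Lemma sum_coord_normalized (R : realType) (J : nat) (L : 'I_J -> nat) (K : nat)
    (Q : {vspace 'rV[R]_(\sum_j L j)}) (lam : K.-tuple 'rV[R]_(\sum_j L j))
    (b : 'rV[R]_(\sum_j L j)) :
  (0 < J)%N -> basis_of Q lam -> normalized_basis lam ->
  b \in Q -> simplexL b -> \sum_(k < K) coord lam k b = 1.
Proof.
move=> J_gt0 lamQ nlam bQ [_ b_sum].
pose j := Ordinal J_gt0; rewrite -[RHS](b_sum j).
under [RHS]eq_bigr do rewrite (cell_coord _ lamQ bQ).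
rewrite exchange_big; apply: eq_bigr => k _.
by rewrite -mulr_sumr nlam mulr1.
Qed.

(** * The multinomial theorem, by counting words *)

Lemma prod_word (R : comNzRingType) (K : nat) (x : 'I_K -> R) (w : seq 'I_K) :
  \prod_(k <- w) x k = \prod_(k < K) x k ^+ count_mem k w.
Proof.
elim: w => [|i w IH]; first by rewrite big_nil big1.
rewrite big_cons IH (bigD1 i) //= [in RHS](bigD1 i) //= eqxx exprS mulrA.
by congr (_ * _); apply: eq_bigr => k /negPf; rewrite eq_sym => ->.
Qed.

Lemma sum_word (R : comNzRingType) (K : nat) (x : 'I_K -> R) (n : nat) :
  (\sum_(k < K) x k) ^+ n = \sum_(w : n.-tuple 'I_K) \prod_(k <- w) x k.
Proof.
transitivity (\prod_(i < n) \sum_(k < K) x k).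
  by rewrite prodr_const card_ord.
rewrite bigA_distr_bigA (reindex (fun w : n.-tuple 'I_K => [ffun i => tnth w i])).
  by apply: eq_bigr => w _; rewrite big_tuple; apply: eq_bigr => i _; rewrite ffunE.
exists (fun f : {ffun 'I_n -> 'I_K} => [tuple f i | i < n]) => [w|f] _.
  by apply: eq_from_tnth => i; rewrite tnth_mktuple ffunE.
by apply/ffunP => i; rewrite ffunE tnth_mktuple.
Qed.

(** Expanding the power gives one term for each word of length n; grouping the
    words by content, that is by their letter counts, yields the coefficients
    C_v. *)
Lemma multinomial_Cv (R : comNzRingType) (K : nat) (x : 'I_K -> R) (n : nat) :
  \sum_(v : {ffun 'I_K -> 'I_n.+1} | vsize (vnat v) == n)
    (Cv (vnat v))%:R * \prod_(k < K) x k ^+ v k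
  = (\sum_(k < K) x k) ^+ n.
Proof.
rewrite sum_word.
pose content (w : n.-tuple 'I_K) : {ffun 'I_K -> 'I_n.+1} :=
  [ffun k => inord (count_mem k w)].
have contentE w k : content w k = count_mem k w :> nat.
  by rewrite ffunE inordK // ltnS -{2}(size_tuple w) count_size.
have content_size w : vsize (vnat (content w)) == n.
  rewrite -{2}(size_tuple w) /vsize /vnat; under eq_bigr do rewrite contentE.
  elim: {w}(tval w) => [|i w IH] /=; first by rewrite big1.
  by rewrite big_split /= (eqP IH) (bigD1 i) //= eqxx big1 // => k /negPf;
    rewrite eq_sym => ->.
rewrite (partition_big content (fun v => vsize (vnat v) == n)) //=.
apply: eq_bigr => v /eqP vn.
transitivity (\sum_(w : n.-tuple 'I_K | content w == v)
    \prod_(k < K) x k ^+ v k); last first.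
  apply: eq_bigr => w /eqP <-; rewrite [RHS]prod_word.
  by apply: eq_bigr => k _; rewrite contentE.
rewrite sumr_const mulr_natl; congr (_ *+ _).
rewrite /Cv vn; apply: eq_card => w; rewrite [LHS]inE -[RHS]/(content w == v).
apply/forallP/eqP => [wv|<- k]; last by rewrite /vnat contentE.
by apply/ffunP => k; apply: ord_inj; rewrite contentE (eqP (wv k)).
Qed.

(** * The system of equations *)

Theorem theorem7p1 (R : realType) (J : nat) (L : 'I_J -> nat)
    (J_gt0 : (0 < J)%N) (L_gt0 : forall j, (0 < L j)%N)
    (mu : probability (borelRL R L) R)
    (mu_simplex : mu (@simplexL R J L) = 1%E)
    (d : measure_display) (Omega : measurableType d) (P : probability Omega R)
    (beta : {mfun Omega >-> borelRL R L})
    (beta_law : forall B : set (borelRL R L), measurable B ->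
       distribution P beta B = mu B)
    (X : forall j : 'I_J, Omega -> 'I_(L j))
    (X_meas : forall j (l : 'I_(L j)), measurable [set w | X j w = l])
    (X_cond : forall j (l : 'I_(L j)),
       is_cond_prob P beta [set w | X j w = l] (fun b => cell b l))
    (hG1 : G1 P beta X)
    (K : nat) (Q : {vspace 'rV[R]_(\sum_j L j)}) (hG2 : G2 mu K Q)
    (lam : K.-tuple 'rV[R]_(\sum_j L j)) (lam_basis : basis_of Q lam) :
  let alpha (k : 'I_K) (j : 'I_J) (l : 'I_(L j)) := cell (tnth lam k) l in
  let h (v : 'I_K -> nat) (ell : mindex L) :=
    moment mu ell * cond_mean P (fun w => Gpow lam v (beta w)) (X_eq X ell) in
  [/\ recurrence_eqs alpha h,
      moment_eqs (moment mu) h &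
      normalized_basis lam -> normalization_eqs h].
Proof.
move=> alpha h.
have [_ mu_Q _] := hG2.
have mS := @measurable_simplexL R J L.
have mQ := measurable_vspace Q.
pose F v ell b := Gpow lam v b * monomial ell b.
have bF v ell : mbounded (@simplexL R J L : set (borelRL R L)) (F v ell).
  by apply: mboundedM; [exact: mbounded_Gpow | exact: mbounded_monomial].
have hE v ell : h v ell = \int[mu]_b F v ell b.
  apply: moment_cond_mean => //.
  - exact: measurable_X_eq.
  - exact: cond_prob_X_eq.
  - by have [] := mbounded_Gpow lam v.
  - by apply: (mbounded_integrable mS mu_simplex); exact: mbounded_Gpow.
have mu_SQ : mu (@simplexL R J L `&` [set b | b \in Q]) = 1%E.
  exact: full_measureI.
have mSQ : measurable (@simplexL R J L `&` [set b | b \in Q] : set (borelRL R L)).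
  exact: measurableI.
split.
- move=> J' v JJ ell j l _ _ _ ellJJ jJJ.
  have ellj : ell j = ord0 by apply/eqP; rewrite ellJJ.
  rewrite [RHS]hE; under [LHS]eq_bigr do rewrite hE.
  rewrite [LHS](Rintegral_lincomb _ _ _ mS mu_simplex) //.
  apply: (eq_Rintegral_full mSQ mu_SQ).
  + have [] // : mbounded (@simplexL R J L : set (borelRL R L))
      (fun b => \sum_(k < K) alpha k j l * F (vincr v k) ell b).
    by apply: mbounded_sum => k _; apply: mboundedM => //; exact: mbounded_cst.
  + by have [] := bF v (add_cat ell l).
  move=> b [_ bQ]; rewrite /F monomial_add_cat // (cell_coord l lam_basis bQ).
  rewrite [RHS]mulrCA mulr_suml.
  by apply: eq_bigr => k _; rewrite Gpow_incr /alpha; ring.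
- move=> ell; rewrite hE; apply: eq_Rintegral => b _.
  by rewrite /F Gpow0 mul1r.
- move=> nlam n _; under [LHS]eq_bigr do rewrite hE.
  rewrite [LHS](Rintegral_lincomb _ _ _ mS mu_simplex) //.
  rewrite (@eq_Rintegral_full _ _ _ mu _ _ (cst 1) mSQ mu_SQ) //.
  + by rewrite Rintegral_cst // mul1r [X in fine X](@probability_setT _ _ _ mu).
  + have [] // : mbounded (@simplexL R J L : set (borelRL R L))
      (fun b => \sum_(v : {ffun 'I_K -> 'I_n.+1} | vsize (vnat v) == n)
         (Cv (vnat v))%:R * F (vnat v) (mindex0 L) b).
    by apply: mbounded_sum => v _; apply: mboundedM => //; exact: mbounded_cst.
  move=> b [bS bQ].
  transitivity ((\sum_(k < K) coord lam k b) ^+ n).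
    rewrite -multinomial_Cv; apply: eq_bigr => v _.
    by rewrite /F monomial0 mulr1.
  by rewrite (sum_coord_normalized J_gt0 lam_basis) // expr1n.
Qed.
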